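(* There exists a family $(I_t)_{t \in T}$ of intervals (in the sense of the context, i.e. segments $\operatorname{conv}\{(0,a),(1,b)\}$ contained in $[0,1]\times[0,1]$) such that $$\bigcup_{t \in T} I_t \supset \{0\} \times [0,1] \quad\text{and}\quad \lambda^2\Big(\bigcup_{t \in T} I_t\Big) = 0 .$$
   Context: An interval means a convex hull $\operatorname{conv}\{(0,a),(1,b)\} \subset \mathbb{R}^2$ (the closed line segment joining $(0,a)$ to $(1,b)$) contained in the square $[0,1]\times[0,1]$. $\lambda^2$ denotes two-dimensional Lebesgue measure on $\mathbb{R}^2$. The index set $T$ is arbitrary (possibly uncountable). *)

(* Defs.v *)
From HB Require Import structures.
From mathcomp Require Import all_boot all_order all_algebra.
From mathcomp Require Import all_classical all_reals all_analysis.

Set Implicit Arguments.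
Unset Strict Implicit.
Unset Printing Implicit Defensive.
Import Order.TTheory GRing.Theory Num.Theory.

Local Open Scope classical_set_scope.
Local Open Scope ring_scope.

Definition conv_hull (R : numDomainType) (M : lmodType R) (A : set M) : set M :=
  smallest (@convex_set R M) A.

(* [R^o] is [R] seen as a module over itself: [plane R] is R^2 as a real
   vector space. *)
Definition plane (R : realType) : lmodType R := (R^o * R^o)%type.

Definition unit_square (R : realType) : set (plane R) := `[0, 1] `*` `[0, 1].

Definition is_interval2 (R : realType) (I : set (plane R)) : Prop :=
  (exists a b : R, I = @conv_hull R (plane R) [set (0, a); (1, b)]) /\
  I `<=` @unit_square R.

Definition borel_lebesgue2 (R : realType) :
    {measure set (measurableTypeR R * measurableTypeR R) -> \bar R} :=
  (@lebesgue_measure R \x @lebesgue_measure R)%E.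

(* [borel_lebesgue2] is the Lebesgue measure on Borel sets only, and its value
   on other sets is not meaningful. [lebesgue2] is its completion: a measure on
   the Lebesgue measurable sets, i.e. those satisfying [lebesgue2_measurable],
   and the outer Lebesgue measure on arbitrary sets. *)
Definition lebesgue2 (R : realType) : set (plane R) -> \bar R :=
  @completed_measure_extension _ _ _ (borel_lebesgue2 R).

Definition lebesgue2_measurable (R : realType) (A : set (plane R)) : Prop :=
  (borel_lebesgue2 R)^*%mu.-cara.-measurable A.

(* Main.v *)
Require Import Defs.
From mathcomp Require Import all_boot all_order all_algebra.
From mathcomp Require Import all_classical all_reals all_analysis.
From mathcomp Require Import measurable_realfun.
From mathcomp Require Import ring lra.

Import Order.TTheory GRing.Theory Num.Theory.

Local Open Scope classical_set_scope.
Local Open Scope ring_scope.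

(** Each left endpoint [(0, a)] is joined to [(1, endpoint a)], where the
    function [endpoint] is chosen so that almost every vertical line meets the
    chords in a null set; Fubini's theorem then concludes.

    Fix a sequence [c_n >= 1] of reals and let [a_n] be [a] rounded down to a
    multiple of [1 / M_n], where [M_n] divides [M_(n+1)] and [M_n] grows very
    fast.  Put
      endpoint a = 1 - \sum_n (c_n - 1) (a_(n+1) - a_n).
    As [a = a_0 + \sum_n (a_(n+1) - a_n)], at abscissa [x] the chord of [a] has
    the ordinate
      x + (1 - x) a_0 + \sum_n (1 - c_n x) (a_(n+1) - a_n).
    The terms of index less than [n] depend only on [a_n], which takes
    [M_n + 1] values for [a] in the unit interval.  The term of index [n] is at
    most [|1 - c_n x| / M_n], and the fast growth of [M] makes the sum of all
    the later ones smaller than [1 / (n M_n)].  So the vertical line at [x] meets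
    the chords inside [M_n + 1] intervals of total length at most a constant
    times [|1 - c_n x| + 1 / n].  Geometrically, the chords of one cell of level
    [n] nearly pass through a common point at abscissa [1 / c_n].

    Let [c_n] visit every neighbourhood of every [y >= 1] at arbitrarily large
    times.  Then, for every [x] in [(0, 1]], this length has infimum 0 over [n]
    ([inv_focus_dense]).  Only the line [x = 0] meets the chords in a set of
    positive length.

    The intervals vary measurably with [x], so their unions over the cells of
    level [n] form a Borel set, [tube n]; the intersection of the tubes is a
    Borel null set containing all the chords.

    Instead of summing a series, [endpoint] is defined as the common point of
    the nested intervals [[upper n a - gap n, upper n a]], where [upper n a] is
    the partial sum and [gap n] bounds the remainder. *)

Section Chords.
Set Implicit Arguments.
Unset Strict Implicit.
Context {R : realType}.
Implicit Types (a x : R) (n k : nat).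

(** * Null sets of the plane *)

(** Fubini; the section above 0 is exempted because a vertical line is null. *)
Lemma null_borel_lebesgue2 (A : set (measurableTypeR R * measurableTypeR R)) :
  measurable A ->
  (forall x, x != 0 -> lebesgue_measure (xsection A x) = 0%E) ->
  borel_lebesgue2 R A = 0%E.
Proof.
move=> mA A0; rewrite /borel_lebesgue2/= /product_measure1.
have m0 : measurable ([set 0] : set (measurableTypeR R)).
  exact: measurable_set1.
rewrite (ge0_negligible_integral m0)//.
- by apply: integral0_eq => x [_ /eqP x0] /=; rewrite A0.
- exact: measurable_fun_xsection.
- exact: lebesgue_measure_set1.
Qed.

(** Only a Borel cover has to be exhibited, since the Carathéodory extension is
    complete. *)
Lemma lebesgue2_null (A : set (measurableTypeR R * measurableTypeR R))
    (E : set (plane R)) :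
  measurable A -> borel_lebesgue2 R A = 0%E -> E `<=` A ->
  lebesgue2_measurable E /\ lebesgue2 E = 0%E.
Proof.
move=> mA A0 EA.
have E0 : lebesgue2 E = 0%E.
  apply/eqP; rewrite eq_le; apply/andP; split; last exact: mu_ext_ge0.
  by rewrite -A0 -(measurable_mu_extE _ mA); exact: le_mu_ext.
split=> //; apply: le_caratheodory_measurable => X.
apply: (@le_trans _ _ (0 + (borel_lebesgue2 R)^*%mu X)%E);
  last by rewrite add0e.
apply: leeD; last by apply: le_outer_measure; exact: subIsetl.
by rewrite -E0; apply: le_outer_measure; exact: subIsetr.
Qed.

(** * Chords of the unit square *)

Definition chord (a b : R) : set (plane R) :=
  [set p | 0 <= p.1 <= 1 /\ p.2 = (1 - p.1) * a + p.1 * b].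

Lemma conv_hull_sub_chord a b :
  @conv_hull R (plane R) [set (0, a); (1, b)] `<=` chord a b.
Proof.
apply: smallest_sub.
  move=> p q t; rewrite !inE => -[/andP[p0 p1] pE] [/andP[q0 q1] qE].
  have t0 : 0 <= t%:num by [].
  have t1 : t%:num <= 1 by [].
  (* [change] unfolds the convexity operator of the product module. *)
  split; last first.
    change (t%:num * p.2 + (1 - t%:num) * q.2 =
      (1 - (t%:num * p.1 + (1 - t%:num) * q.1)) * a +
      (t%:num * p.1 + (1 - t%:num) * q.1) * b).
    by rewrite pE qE; ring.
  change (0 <= t%:num * p.1 + (1 - t%:num) * q.1 <= 1).
  by apply/andP; split; nra.
by move=> _ [->|->]; split => /=; rewrite ?lexx ?ler01// ?subr0 ?subrr; ring.
Qed.

Lemma chord_sub_square a b : 0 <= a <= 1 -> 0 <= b <= 1 ->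
  chord a b `<=` @unit_square R.
Proof.
move=> /andP[a0 a1] /andP[b0 b1] [x y] [/= /andP[x0 x1] ->].
by split; rewrite /= in_itv/=; apply/andP; split => //; nra.
Qed.

(** * Nested grids and the right endpoints *)

(** The number [c_n].  Writing [n.+1] as [2 ^ q * 3 ^ p] realizes every fraction
    [p / q.+1] at a time [n >= q]. *)
Definition inv_focus n : R := 1 + (logn 3 n.+1)%:R / (logn 2 n.+1).+1%:R.

(** The ratio [M_n / M_(n-1)], at least [2 (n + 1) c_n]: the terms of the series
    of index [n] and more, of total size about [c_n / M_n], are then negligible
    compared with the length [1 / M_(n-1)] of the previous cells.  For [n = 0]
    it keeps [endpoint] nonnegative. *)
Definition refinement n : nat := (2 * n.+1 * (logn 3 n.+1).+1)%N.

Arguments refinement : simpl never.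

Fixpoint ncells n : nat :=
  if n is m.+1 then (ncells m * refinement m.+1)%N else refinement 0.

Definition cell n a : nat := Num.truncn (a * (ncells n)%:R).

Definition trunc n a : R := (cell n a)%:R / (ncells n)%:R.

Definition upper n a : R :=
  1 - \sum_(k < n) (inv_focus k - 1) * (trunc k.+1 a - trunc k a).

(** The remainder of the series is at most [\sum_(m >= n) c_m / M_m]; its terms
    decrease at least geometrically with ratio [1 / 2], hence the factor 2. *)
Definition gap n : R := 2 * inv_focus n / (ncells n)%:R.

Definition endpoint a : R := sup (range (fun n => upper n a - gap n)).

Lemma inv_focus_ge1 n : 1 <= inv_focus n.
Proof. by rewrite lerDl divr_ge0. Qed.

Lemma inv_focus_le_refinement n :
  2 * n.+1%:R * inv_focus n <= (refinement n)%:R.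
Proof.
rewrite /refinement natrM natrM ler_wpM2l// -[leRHS]natr1 /inv_focus
  addrC lerD2r.
by rewrite ler_pdivrMr ?ltr0n// ler_peMr// ler1n.
Qed.

(** Approximate [x^-1 - 1] from below by [p / q.+1]; the distance is less than
    [1 / q.+1], and [n = 2 ^ q * 3 ^ p - 1] is at least [q]. *)
Lemma inv_focus_dense x e : 0 < x <= 1 -> 0 < e ->
  exists n, `|1 - inv_focus n * x| + n.+2%:R^-1 < e.
Proof.
move=> /andP[x0 x1] e0; pose q := Num.truncn (2 / e).
have qe : q.+1%:R^-1 < e / 2.
  by rewrite -[ltRHS]invf_div ltf_pV2 ?posrE ?ltr0n ?divr_gt0// truncnS_gt.
have y0 : 0 <= q.+1%:R * (x^-1 - 1) by rewrite mulr_ge0// subr_ge0 invf_ge1.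
pose p := Num.truncn (q.+1%:R * (x^-1 - 1)).
have /andP[p1 p2] := truncn_itv y0.
exists (2 ^ q * 3 ^ p).-1.
have N0 : (0 < 2 ^ q * 3 ^ p)%N by rewrite muln_gt0 !expn_gt0.
rewrite /inv_focus prednK//.
have -> : logn 3 (2 ^ q * 3 ^ p) = p.
  by rewrite lognM ?expn_gt0// !lognX !logn_prime//= muln0 muln1.
have -> : logn 2 (2 ^ q * 3 ^ p) = q.
  by rewrite lognM ?expn_gt0// !lognX !logn_prime//= muln0 muln1 addn0.
have -> : e = e / 2 + e / 2 by lra.
apply: ltrD; last first.
  apply: le_lt_trans qe; rewrite lef_pV2 ?posrE ?ltr0n// ler_nat ltnS.
  apply: leq_trans (leq_pmulr _ _); last by rewrite expn_gt0.
  by apply/ltnW/ltn_expl.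
apply: le_lt_trans qe.
set s := q.+1%:R in p1 p2 y0 *.
have s0 : 0 < s by rewrite ltr0n.
have -> : 1 - (1 + p%:R / s) * x = (s * (x^-1 - 1) - p%:R) * x * s^-1.
  by rewrite mulrBl mulrBl; field; rewrite !gt_eqF.
move: p2; rewrite -natr1 => p2.
rewrite ger0_norm; last by rewrite !mulr_ge0 ?invr_ge0 ?subr_ge0// ltW.
rewrite ler_piMl ?invr_ge0 ?(ltW s0)//.
rewrite mulr_ile1 ?subr_ge0// ?(ltW x0)//.
by rewrite lerBlDl ltW.
Qed.

Lemma refinement_gt0 n : (0 < refinement n)%N.
Proof. by rewrite !muln_gt0. Qed.

Lemma ncells_gt0 n : (0 < ncells n)%N.
Proof. by elim: n => [|n IH] /=; rewrite ?refinement_gt0 ?muln_gt0 ?IH. Qed.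

Lemma ncellsR_gt0 n : 0 < (ncells n)%:R :> R.
Proof. by rewrite ltr0n ncells_gt0. Qed.

Lemma gap_succ n : gap n.+1 <= n.+2%:R^-1 / (ncells n)%:R.
Proof.
rewrite /gap /= natrM invfM mulrA ler_pdivrMr; last first.
  by rewrite ltr0n refinement_gt0.
rewrite [leRHS]mulrAC ler_wpM2r ?invr_ge0 ?ler0n//.
rewrite ler_pdivlMl ?ltr0n// mulrCA mulrA.
exact: inv_focus_le_refinement.
Qed.

(** One step of the partial sums moves [upper] by at most [c_n / M_n], so this
    is what makes the intervals [[upper n a - gap n, upper n a]] nested. *)
Lemma gap_step n : inv_focus n / (ncells n)%:R <= gap n - gap n.+1.
Proof.
rewrite lerBrDl -lerBrDr.
apply: le_trans (gap_succ n) _.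
rewrite /gap -mulrBl ler_wpM2r ?invr_ge0 ?ler0n//.
have := inv_focus_ge1 n.
have : n.+2%:R^-1 <= 1 :> R by rewrite invf_le1 ?ler1n ?ltr0n.
by move: (n.+2%:R^-1) (inv_focus n) => i s; lra.
Qed.

Lemma gap0_le1 : gap 0 <= 1.
Proof.
rewrite /gap ler_pdivrMr ?ncellsR_gt0// mul1r /=.
by have := inv_focus_le_refinement 0; rewrite mulr1.
Qed.

Lemma trunc_itv n a : 0 <= a -> trunc n a <= a < trunc n a + (ncells n)%:R^-1.
Proof.
move=> a0; have M0 := ncellsR_gt0 n.
have /andP[h1 h2] : _ <= a * (ncells n)%:R < _ :=
  truncn_itv (mulr_ge0 a0 (ltW M0)).
rewrite /trunc -[X in _ + X]mul1r -mulrDl ler_pdivrMr// ltr_pdivlMr//.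
by rewrite h1 natr1.
Qed.

Lemma cell_coarsen n a : 0 <= a ->
  cell n a = (cell n.+1 a %/ refinement n.+1)%N.
Proof.
move=> a0; have K0 := refinement_gt0 n.+1; have M0 := ncellsR_gt0 n.
have am m : 0 <= a * (ncells m)%:R by rewrite mulr_ge0.
apply/eqP; rewrite truncn_eq//; apply/andP; split.
  rewrite -(ler_pM2r (_ : 0 < (refinement n.+1)%:R)) ?ltr0n//.
  rewrite -mulrA -!natrM -truncn_ge_nat; last exact: (am n.+1).
  exact: leq_divM.
rewrite -(ltr_pM2r (_ : 0 < (refinement n.+1)%:R)) ?ltr0n//.
rewrite -mulrA -!natrM -truncn_lt_nat; last exact: (am n.+1).
exact: ltn_ceil.
Qed.

Lemma trunc_le_succ n a : 0 <= a -> trunc n a <= trunc n.+1 a.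
Proof.
move=> a0; have K0 := refinement_gt0 n.+1.
rewrite /trunc ler_pdivrMr ?ncellsR_gt0//= natrM (mulrC (ncells n)%:R) invfM.
rewrite mulrA divfK ?gt_eqF ?ncellsR_gt0//.
rewrite ler_pdivlMr ?ltr0n//.
by rewrite -natrM ler_nat cell_coarsen// leq_divM.
Qed.

Lemma trunc_step n a : 0 <= a ->
  0 <= trunc n.+1 a - trunc n a <= (ncells n)%:R^-1.
Proof.
move=> a0; rewrite subr_ge0 trunc_le_succ//= lerBlDl.
have /andP[_ /ltW] := trunc_itv n a0; apply: le_trans.
by have /andP[] := trunc_itv n.+1 a0.
Qed.

Lemma upper_succ n a :
  upper n.+1 a = upper n a - (inv_focus n - 1) * (trunc n.+1 a - trunc n a).
Proof. by rewrite /upper big_ord_recr/= opprD addrA. Qed.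

Lemma upper_nonincreasing a : 0 <= a -> nonincreasing_seq (upper ^~ a).
Proof.
move=> a0; apply/nonincreasing_seqP => n; rewrite upper_succ gerBl.
have /andP[? _] := trunc_step n a0.
by rewrite mulr_ge0// subr_ge0 inv_focus_ge1.
Qed.

Lemma lower_nondecreasing a : 0 <= a ->
  nondecreasing_seq (fun n => upper n a - gap n).
Proof.
move=> a0; apply/nondecreasing_seqP => n; rewrite upper_succ.
have /andP[t0 t1] := trunc_step n a0.
have s1 := inv_focus_ge1 n.
have : (inv_focus n - 1) * (trunc n.+1 a - trunc n a)
    <= inv_focus n / (ncells n)%:R.
  by apply: ler_pM => //; lra.
by have := gap_step n; lra.
Qed.

Lemma endpoint_itv n a : 0 <= a ->
  upper n a - gap n <= endpoint a <= upper n a.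
Proof.
move=> a0.
have ub m : ubound (range (fun k => upper k a - gap k)) (upper m a).
  move=> _ [k _ <-].
  apply: le_trans (upper_nonincreasing a0 (leq_maxr k m)).
  apply: le_trans (lower_nondecreasing a0 (leq_maxl k m)) _ => /=.
  rewrite gerBl; rewrite /gap divr_ge0// mulr_ge0//.
  by apply: le_trans (inv_focus_ge1 _).
apply/andP; split.
  by apply: ub_le_sup; [exists (upper 0 a); exact: ub | exists n].
by apply: ge_sup; [exists (upper n a - gap n), n | exact: ub].
Qed.

Lemma endpoint_unit a : 0 <= a -> 0 <= endpoint a <= 1.
Proof.
move=> a0; have := endpoint_itv 0 a0.
rewrite {1 2}/upper big_ord0 subr0 => /andP[h ->]; rewrite andbT.
by apply: le_trans h; rewrite subr_ge0 gap0_le1.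
Qed.

(** Each grid refines the previous one, so the cell of level [n] determines all
    the earlier ones, and with them the partial sum. *)
Lemma upper_cell n a a' : 0 <= a -> 0 <= a' -> cell n a = cell n a' ->
  upper n a = upper n a'.
Proof.
move=> a0 a'0; elim: n => [|n IH] aa'; first by rewrite /upper !big_ord0.
have caa' : cell n a = cell n a'.
  by rewrite (cell_coarsen n a0) (cell_coarsen n a'0) aa'.
by rewrite !upper_succ IH// /trunc aa' caa'.
Qed.

Lemma upper_trunc n a : 0 <= a -> upper n (trunc n a) = upper n a.
Proof.
move=> a0; apply: upper_cell => //.
  by rewrite divr_ge0.
by rewrite {1}/cell /trunc divfK ?natrK// gt_eqF// ncellsR_gt0.
Qed.

(** The chord of [a] is compared with the approximate chord of the left end of
    its cell, one of finitely many.  Their distance is the term of index [n], equal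
    to [(1 - c_n x) (a_(n+1) - a_n)], plus a barycentre with weights [1 - x] and
    [x] of two errors of size at most [gap n.+1]. *)
Lemma chord_near_strand n a x : 0 <= a -> 0 <= x <= 1 ->
  `|(1 - x) * a + x * endpoint a
     - ((1 - x) * trunc n a + x * upper n (trunc n a))|
  <= (`|1 - inv_focus n * x| + n.+2%:R^-1) / (ncells n)%:R.
Proof.
move=> a0 /andP[x0 x1]; rewrite upper_trunc//.
have /andP[b0 b1] := endpoint_itv n.+1 a0.
have /andP[t0 t1] := trunc_step n a0.
have /andP[r0 r1] := trunc_itv n.+1 a0.
have g1 := gap_succ n.
have mg : (ncells n.+1)%:R^-1 <= gap n.+1.
  by rewrite /gap ler_peMl ?invr_ge0//; have := inv_focus_ge1 n.+1; lra.
rewrite upper_succ in b0 b1.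
set d := trunc n.+1 a - trunc n a in t0 t1 b0 b1.
have -> : (1 - x) * a + x * endpoint a - ((1 - x) * trunc n a + x * upper n a)
  = (1 - inv_focus n * x) * d + ((1 - x) * (a - trunc n.+1 a)
    - x * (upper n a - (inv_focus n - 1) * d - endpoint a)) by rewrite /d; ring.
rewrite [leRHS]mulrDl; apply: le_trans (ler_normD _ _) (lerD _ _).
  by rewrite normrM ler_wpM2l// ger0_norm.
apply: le_trans g1.
set g := gap n.+1 in mg b0 *.
have g0 : 0 <= g by apply: le_trans mg; rewrite invr_ge0.
have h1 : 0 <= (1 - x) * (a - trunc n.+1 a) <= (1 - x) * g.
  by rewrite mulr_ge0 ?ler_wpM2l//; clear -b0 b1 r0 r1 x0 x1 mg; lra.
have h2 : 0 <= x * (upper n a - (inv_focus n - 1) * d - endpoint a) <= x * g.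
  by rewrite mulr_ge0 ?ler_wpM2l//; clear -b0 b1 r0 r1 x0 x1 mg; lra.
have : (1 - x) * g + x * g = g by ring.
move: ((1 - x) * g) (x * g) h1 h2 => g1 g2 /andP[? ?] /andP[? ?] ?.
by rewrite ler_norml; apply/andP; split; lra.
Qed.

(** * The Borel null set containing the chords *)

Definition strand n k x : R :=
  (1 - x) * (k%:R / (ncells n)%:R) + x * upper n (k%:R / (ncells n)%:R).

Definition radius n x : R :=
  (`|1 - inv_focus n * x| + n.+2%:R^-1) / (ncells n)%:R.

(** The index [k = M_n] is that of the cell of [a = 1]. *)
Definition tube n : set (measurableTypeR R * measurableTypeR R) :=
  \bigcup_(k < (ncells n).+1)
    [set p | `|p.2 - strand n k p.1| <= radius n p.1].

Definition null_cover : set (measurableTypeR R * measurableTypeR R) :=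
  (`[0, 1] `*` setT) `&` \bigcap_n tube n.

Lemma measurable_tube n : measurable (tube n).
Proof.
apply: bigcup_measurable => k _; rewrite -[X in measurable X]setTI.
apply: measurable_fun_le => //.
  apply: measurableT_comp => //; apply: measurable_funB => //.
  apply: measurable_funD; apply: measurable_funM => //.
  exact: measurable_funB.
apply: measurable_funM => //; apply: measurable_funD => //.
apply: measurableT_comp => //; apply: measurable_funB => //.
exact: measurable_funM.
Qed.

Lemma measurable_null_cover : measurable null_cover.
Proof.
apply: measurableI; first exact: measurableX.
by apply: bigcap_measurable => [|n _]; [exists 0 | exact: measurable_tube].
Qed.

(** There are [M_n + 1 <= 2 M_n] intervals, each of length [2 * radius n x]. *)
Lemma tube_xsection n x :
  (lebesgue_measure (xsection (tube n) x)
    <= (4 * (`|1 - inv_focus n * x| + n.+2%:R^-1))%:E)%E.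
Proof.
have w0 : 0 <= radius n x by rewrite divr_ge0 ?addr_ge0 ?invr_ge0.
pose fiber k := `[strand n k x - radius n x, strand n k x + radius n x]%classic.
have -> : xsection (tube n) x = \big[setU/set0]_(k < (ncells n).+1) fiber k.
  rewrite -bigcup_mkord; apply/seteqP; split => y;
    rewrite /xsection /fiber /= ?inE => -[k kn] /= h;
    by exists k => //=; move: h; rewrite in_itv/= ler_distl.
apply: le_trans (Boole_inequality _ _) _.
  by move=> k _; exact: measurable_itv.
rewrite (eq_bigr (fun=> (2 * radius n x)%:E)); last first.
  move=> k _; rewrite /= /fiber lebesgue_measure_itv/= lte_fin.
  by case: ltP => h; rewrite -?EFinB; congr EFin;
    move: (radius n x) w0 h => w; lra.
rewrite sumEFin lee_fin sumr_const card_ord /radius.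
set w := _ + _; have w1 : 0 <= w by rewrite addr_ge0 ?invr_ge0.
have -> : 2 * (w / (ncells n)%:R) *+ (ncells n).+1
    = w * (2 * (1 + (ncells n)%:R^-1)).
  by rewrite -mulr_natr -natr1; field; rewrite gt_eqF ?ncellsR_gt0.
rewrite mulrC ler_wpM2r//.
have : (ncells n)%:R^-1 <= 1 :> R by rewrite invf_le1 ?ler1n ?ltr0n ?ncells_gt0.
by move: ((ncells n)%:R^-1) => i; lra.
Qed.

(** The section lies in that of every tube, and [n] can be chosen, depending on
    [x], to make the latter as short as desired. *)
Lemma null_cover_xsection x : x != 0 ->
  lebesgue_measure (xsection null_cover x) = 0%E.
Proof.
move=> xn0; have [x01|x01] := boolP (0 < x <= 1); last first.
  rewrite (_ : xsection _ _ = set0) ?measure0// -subset0 => y.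
  rewrite /xsection /= inE => -[[/= + _] _]; rewrite in_itv/= => /andP[x0 x1].
  by move: x01; rewrite lt_neqAle eq_sym xn0 x0 x1.
apply/eqP; rewrite eq_le measure_ge0 andbT; apply/lee_addgt0Pr => e e0.
rewrite add0e; have e4 : 0 < e / 4 by rewrite divr_gt0.
have [n] := inv_focus_dense x01 e4; rewrite ltr_pdivlMr// mulrC => /ltW ne.
apply: (@le_trans _ _ (lebesgue_measure (xsection (tube n) x))); last first.
  by apply: le_trans (tube_xsection n x) _; rewrite lee_fin.
apply: le_measure; rewrite ?inE.
- by apply: measurable_xsection; exact: measurable_null_cover.
- by apply: measurable_xsection; exact: measurable_tube.
- by apply: le_xsection => p [_ /(_ n)]; exact.
Qed.

Lemma chord_sub_null_cover a : 0 <= a <= 1 ->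
  chord a (endpoint a) `<=` null_cover.
Proof.
move=> /andP[a0 a1] [x y] [/= x01 ->]; split=> [|n _].
  by split => //=; rewrite in_itv.
exists (cell n a); last exact: chord_near_strand.
rewrite /= ltnS truncn_le_nat; apply: (@le_lt_trans _ _ (ncells n)%:R).
  by rewrite ler_piMl.
by rewrite ltr_nat.
Qed.

End Chords.

Theorem theorem1 (R : realType) :
  exists (T : Type) (I : T -> set (plane R)),
    [/\ forall t : T, is_interval2 (I t),
        [set 0] `*` `[0, 1] `<=` \bigcup_(t in [set: T]) I t,
        lebesgue2_measurable (\bigcup_(t in [set: T]) I t) &
        lebesgue2 (\bigcup_(t in [set: T]) I t) = 0%E].
Proof.
pose I (t : {a : R | 0 <= a <= 1}) : set (plane R) :=
  @conv_hull R (plane R) [set (0, val t); (1, endpoint (val t))].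
have Ichord t : I t `<=` chord (val t) (endpoint (val t)).
  exact: conv_hull_sub_chord.
have [mI I0] : lebesgue2_measurable (\bigcup_(t in setT) I t) /\
    lebesgue2 (\bigcup_(t in setT) I t) = 0%E.
  apply: lebesgue2_null measurable_null_cover _ _.
    exact: null_borel_lebesgue2 measurable_null_cover null_cover_xsection.
  apply: bigcup_sub => t _; apply: subset_trans (Ichord t) _.
  exact: chord_sub_null_cover (valP t).
exists {a : R | 0 <= a <= 1}, I; split => //.
  move=> t; split; first by exists (val t), (endpoint (val t)).
  apply: subset_trans (Ichord t) _; apply: chord_sub_square (valP t) _.
  by apply: endpoint_unit; case/andP: (valP t).
move=> [x y] [/= -> y01]; rewrite in_itv in y01.
exists (exist _ y y01) => //.
by apply: (@sub_smallest _ _ _ [set (0, y); (1, endpoint y)]) => //; left.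
Qed.
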